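(* Let $G$ be any graph, and let $\alpha$ be its independence number. Then $$\mathrm{cub}(G)\le \mathrm{box}(G)\,\lceil \log_2\alpha\rceil .$$
   Context: Graphs are simple and undirected. A $b$-dimensional box is a Cartesian product $R_1\times R_2\times\cdots\times R_b$, where each $R_i$ is a closed interval on the real line; when each interval has unit length, the box is called a $b$-dimensional cube. The cubicity $\mathrm{cub}(G)$ (respectively boxicity $\mathrm{box}(G)$) of a graph $G$ is the minimum positive integer $b$ such that the vertices of $G$ can be mapped to axis-parallel $b$-dimensional cubes (respectively boxes) in such a way that two vertices are adjacent in $G$ if and only if their assigned cubes (respectively boxes) intersect. The independence number $\alpha$ of $G$ is the maximum size of an independent set of vertices of $G$.
   Formalization: The independence number is assumed to be at least 2: for complete graphs cub = box = 1 while ⌈log₂ 1⌉ = 0, so the inequality fails, and for the graph without vertices log₂ α is undefined. *)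

(* Defs.v *)
From HB Require Import structures.
From mathcomp Require Import all_boot all_order all_algebra.
From mathcomp Require Import boolp classical_sets set_interval reals exp.
From mathcomp Require Import lra.

Set Implicit Arguments.
Unset Strict Implicit.
Unset Printing Implicit Defensive.

Import Order.TTheory GRing.Theory Num.Theory.
Local Open Scope classical_set_scope.
Local Open Scope ring_scope.

Record sgraph := SGraph {
  vertex :> finType;
  adj : rel vertex;
  adj_sym : symmetric adj;
  adj_irr : irreflexive adj }.

Definition independent (G : sgraph) (S : {set G}) : bool :=
  [forall u in S, forall v in S, ~~ adj u v].

Definition independence_number (G : sgraph) : nat :=
  \max_(S : {set G} | independent S) #|S|.

Section Representations.
Variable R : realType.

Definition is_box (b : nat) (B : set 'rV[R]_b) : Prop :=
  exists l r : 'I_b -> R, (forall i, l i <= r i) /\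
    B = [set p | forall i, p 0 i \in `[l i, r i]].

Definition is_cube (b : nat) (B : set 'rV[R]_b) : Prop :=
  exists l : 'I_b -> R, B = [set p | forall i, p 0 i \in `[l i, l i + 1]].

(* Adjacency is only tested on distinct vertices: a nonempty box always meets
   itself. Distinct vertices may be assigned the same box. *)
Definition represents (G : sgraph) (b : nat) (f : G -> set 'rV[R]_b) : Prop :=
  forall u v : G, u != v -> (adj u v <-> f u `&` f v !=set0).

Definition has_box_rep (G : sgraph) (b : nat) : Prop :=
  exists f : G -> set 'rV[R]_b, (forall v, is_box (f v)) /\ represents f.

Definition has_cube_rep (G : sgraph) (b : nat) : Prop :=
  exists f : G -> set 'rV[R]_b, (forall v, is_cube (f v)) /\ represents f.

Lemma is_cube_box (b : nat) (B : set 'rV[R]_b) : is_cube B -> is_box B.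
Proof.
by move=> [l ->]; exists l, (fun i => l i + 1); split=> // i; rewrite lerDl.
Qed.

(* The coordinate of a vertex w puts w on [0, 1], its neighbours on [1, 2] and
   all other vertices on [2, 3]; the last coordinate only ensures that the
   dimension is positive. *)
Lemma has_cube_rep_ex (G : sgraph) : has_cube_rep G #|G|.+1.
Proof.
pose pos (u : G) (i : 'I_#|G|.+1) : R :=
  if insub (val i) is Some j then
    let w : G := enum_val (j : 'I_#|G|) in
    if u == w then 0 else if adj u w then 1 else 2
  else 0.
exists (fun u => [set p | forall i, p 0 i \in `[pos u i, pos u i + 1]]).
split=> [v|u v neq_uv]; first by exists (pos v).
split=> [uv|[p [pu pv]]].
- exists (\row_i Num.max (pos u i) (pos v i)).
  suff le1 i : pos u i <= pos v i + 1 /\ pos v i <= pos u i + 1.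
    split=> i /=; have [? ?] := le1 i;
    rewrite mxE in_itv /= le_max ge_max lexx ?orbT /= ?lerDl ?ler01 ?andbT //.
  have vu : adj v u by rewrite adj_sym.
  rewrite /pos; case: insubP => [j _ _|_]; last by rewrite add0r ler01.
  have [uw|] := eqVneq u (enum_val j).
    by rewrite -uw eq_sym (negbTE neq_uv) vu; split; lra.
  have [vw|] := eqVneq v (enum_val j).
    by rewrite -vw uv; split; lra.
  by move=> _ _; do 2 case: ifP => _; split; lra.
- apply: contrapT => /negP nuv.
  have lt_i : (enum_rank u < #|G|.+1)%N by rewrite ltnS ltnW.
  pose i : 'I_#|G|.+1 := Ordinal lt_i.
  have posE w : pos w i = if w == u then 0 else if adj w u then 1 else 2.
    rewrite /pos /=; case: insubP => [j _ jE|]; last by rewrite ltn_ord.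
    by rewrite (_ : j = enum_rank u) ?enum_rankK //; apply: val_inj.
  move: (pu i) (pv i); rewrite /= !posE eqxx eq_sym (negbTE neq_uv).
  rewrite adj_sym (negbTE nuv) !in_itv /= => /andP[_ p1] /andP[p2 _].
  by move: p1 p2; lra.
Qed.

Lemma cubicity_ex (G : sgraph) :
  exists b : nat, (0 < b)%N && `[< has_cube_rep G b >].
Proof. by exists #|G|.+1; apply/asboolP/has_cube_rep_ex. Qed.

Lemma boxicity_ex (G : sgraph) :
  exists b : nat, (0 < b)%N && `[< has_box_rep G b >].
Proof.
have [f [fC fG]] := has_cube_rep_ex G.
by exists #|G|.+1; apply/asboolP; exists f; split=> // v; apply: is_cube_box.
Qed.

Definition cubicity (G : sgraph) : nat := ex_minn (cubicity_ex G).

Definition boxicity (G : sgraph) : nat := ex_minn (boxicity_ex G).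

Definition log2 (x : R) : R := ln x / ln 2.

End Representations.

(* Main.v *)
(** Let [G] be represented by boxes, and let [h j v] be the largest size of an
    independent set all of whose members lie strictly to the left of [v] in
    direction [j]. Then [h j v] is less than the independence number, and
    [h j u < h j v] whenever [u] lies strictly to the left of [v] in direction
    [j]. In that case some binary digit [i] is 0 in [h j u] and 1 in [h j v].
    For each pair [(j, i)] we take one cube coordinate: with boxes scaled to be
    small, a vertex whose digit is 0 starts at its right end, and a vertex whose
    digit is 1 starts at its left end plus 1. The only pairs that this coordinate
    separates are a digit-0 vertex lying strictly to the left of a digit-1
    vertex, so no adjacent pair is separated, and every nonadjacent pair is
    separated by some coordinate. *)
Require Import Defs.
From mathcomp Require Import all_boot all_order all_algebra.
From mathcomp Require Import reals.
From mathcomp Require Import boolp classical_sets exp.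
From mathcomp Require Import zify lra.
Import Order.TTheory GRing.Theory Num.Theory.
Local Open Scope classical_set_scope.
Local Open Scope ring_scope.

Lemma exists_digit_lt (k a b : nat) : (a < b < 2 ^ k)%N ->
  exists i : 'I_k, ~~ odd (a %/ 2 ^ i) && odd (b %/ 2 ^ i).
Proof.
elim: k a b => [|k IHk] a b /andP[ab bk]; first by move: bk; rewrite expn0; lia.
have [ab2|ab2] := ltnP (a %/ 2) (b %/ 2).
  have /IHk[i digits] : (a %/ 2 < b %/ 2 < 2 ^ k)%N.
    by rewrite ab2 ltn_divLR // -expnSr.
  by exists (lift ord0 i); rewrite lift0 expnS !divnMA.
(* The halves are equal here, so [a < b] forces last digits 0 and 1. *)
by exists ord0; rewrite expn0 !divn1; lia.
Qed.

Lemma independentP (G : sgraph) (S : {set G}) :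
  reflect {in S &, forall u v, ~~ adj u v} (independent S).
Proof.
apply: (iffP forall_inP) => [SP u v uS vS|SP u uS].
  by have /forall_inP := SP u uS; apply.
by apply/forall_inP => v vS; apply: SP.
Qed.

Section Cubicity.
Variable R : realType.

Lemma box_meet (b : nat) (l r l' r' : 'I_b -> R) :
  (forall i, l i <= r i) -> (forall i, l' i <= r' i) ->
  ([set p : 'rV[R]_b | forall i, p 0 i \in `[l i, r i]] `&`
   [set p | forall i, p 0 i \in `[l' i, r' i]] !=set0) <->
  forall i, l i <= r' i /\ l' i <= r i.
Proof.
move=> lr lr'; split=> [[p [/= pl pl'] i]|meet].
  move: (pl i) (pl' i); rewrite !in_itv /= => /andP[? ?] /andP[? ?].
  by split; lra.
(* The larger of the two left ends lies in both intervals. *)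
exists (\row_i Num.max (l i) (l' i)); split=> i /=; have [? ?] := meet i;
  by rewrite mxE in_itv /= le_max ge_max lexx ?orbT ?lr ?lr' ?andbT.
Qed.

Lemma has_box_rep_ends (G : sgraph) (b : nat) : has_box_rep R G b ->
  exists l r : G -> 'I_b -> R, (forall v i, l v i <= r v i) /\
    forall u v, u != v ->
      (adj u v <-> forall i, l u i <= r v i /\ l v i <= r u i).
Proof.
move=> [f [/choice[l /choice[r fE]] fG]]; exists l, r.
have lr v : forall i, l v i <= r v i by have [] := fE v.
split=> // u v uv; rewrite -box_meet //.
by have [_ <-] := fE u; have [_ <-] := fE v; apply: fG.
Qed.

(** Unit intervals meet exactly when their left ends differ by at most 1. A general [I] lets
    coordinates be pairs of a direction and a digit. *)
Lemma has_cube_rep_pos (G : sgraph) (I : finType) (pos : G -> I -> R) :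
  (forall u v, u != v -> (adj u v <-> forall i, `|pos u i - pos v i| <= 1)) ->
  has_cube_rep R G #|I|.
Proof.
move=> posG.
exists (fun v => [set p | forall i,
  p 0 i \in `[pos v (enum_val i), pos v (enum_val i) + 1]]).
split=> [v|u v uv]; first by exists (fun i => pos v (enum_val i)).
rewrite box_meet => [|i|i]; rewrite ?lerDl ?ler01 //.
apply: iff_trans (posG u v uv) _; split=> [near i|near i].
  by have := near (enum_val i); rewrite ler_norml => /andP[? ?]; split; lra.
have := near (enum_rank i); rewrite enum_rankK ler_norml => -[? ?].
by apply/andP; split; lra.
Qed.

Section Height.
Variables (G : sgraph) (l r : G -> R).
Hypothesis le_lr : forall v, l v <= r v.
Hypothesis adj_meet : forall u v, r u < l v -> ~~ adj u v.

(** This is [h j v] for one fixed direction [j]. Members of [S] need not be ordered in that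
    direction; other directions may separate them. *)
Definition chain_height (v : G) : nat :=
  \max_(S : {set G} | independent S && [forall u in S, r u < l v]) #|S|.

(** Adding [v] is the source of both strict inequalities on heights below; [v] is new because no
    vertex lies strictly left of itself. *)
Lemma independent_add (S : {set G}) (v : G) :
  independent S -> {in S, forall u, r u < l v} ->
  independent (v |: S) /\ #|v |: S| = #|S|.+1.
Proof.
move=> /independentP indepS left_v; split.
  apply/independentP => x y /setU1P[->|xS] /setU1P[->|yS].
  - by rewrite adj_irr.
  - by rewrite adj_sym adj_meet ?left_v.
  - by rewrite adj_meet ?left_v.
  - exact: indepS.
rewrite cardsU1 (_ : v \notin S) //; apply/negP => /left_v.
by rewrite ltNge le_lr.
Qed.

Lemma chain_height_witness (v : G) : exists S : {set G},
  [/\ independent S, {in S, forall u, r u < l v} & chain_height v = #|S|].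
Proof.
have P0 : independent (finset.set0 : {set G}) && [forall u in (finset.set0 : {set G}), r u < l v].
  by apply/andP; split; apply/forall_inP => u; rewrite inE.
rewrite /chain_height (bigop.bigmax_eq_arg finset.set0) //.
case: arg_maxnP => // S /andP[indepS /forall_inP left_v] _.
by exists S.
Qed.

Lemma chain_height_lt (v : G) : (chain_height v < independence_number G)%N.
Proof.
have [S [indepS left_v ->]] := chain_height_witness v.
have [indep <-] := independent_add _ _ indepS left_v.
exact: (bigop.bigmax_sup (v |: S)%SET).
Qed.

Lemma chain_height_mono (u v : G) :
  r u < l v -> (chain_height u < chain_height v)%N.
Proof.
move=> uv; have [S [indepS left_u ->]] := chain_height_witness u.
have [indep <-] := independent_add _ _ indepS left_u.
apply: (bigop.bigmax_sup (u |: S)%SET) => //.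
rewrite indep /=; apply/forall_inP => w /setU1P[->//|/left_u wu].
(* [r w < l u <= r u < l v]. *)
by have := le_lr u; lra.
Qed.

End Height.

Lemma finite_norm_bound (T : finType) (f : T -> R) :
  exists2 M : R, 0 < M & forall x, `|f x| <= M.
Proof.
(* The summand 1 keeps the bound positive even when [T] is empty. *)
exists (1 + \sum_x `|f x|) => [|x]; first by rewrite ltr_pwDl ?sumr_ge0.
by rewrite (bigD1 x) //= addrCA lerDl addr_ge0 ?sumr_ge0.
Qed.

Lemma has_cube_rep_mul (G : sgraph) (b k : nat) :
  (independence_number G <= 2 ^ k)%N -> has_box_rep R G b ->
  has_cube_rep R G (b * k).
Proof.
move=> alpha_le /has_box_rep_ends[l [r [le_lr adjP]]].
have adj_meet j u v : r u j < l v j -> ~~ adj u v.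
  move=> uv; have neq_uv : u != v.
    by apply: contraTneq uv => ->; rewrite -leNgt.
  apply/negP => /(adjP _ _ neq_uv)/(_ j)[_].
  by rewrite leNgt uv.
have [Ml Ml_gt0 lM] := finite_norm_bound _ (fun x : G * 'I_b => l x.1 x.2).
have [Mr Mr_gt0 rM] := finite_norm_bound _ (fun x : G * 'I_b => r x.1 x.2).
(* Any two endpoints differ by at most [W], so vertices with equal digits are never separated. *)
pose W := 2 * (Ml + Mr); have W_gt0 : 0 < W by rewrite /W; lra.
pose digit (x : 'I_b * 'I_k) v :=
  odd (chain_height G (l^~ x.1) (r^~ x.1) v %/ 2 ^ x.2).
pose pos v x := (if digit x v then l v x.1 + W else r v x.1) / W.
have posE u v x : (`|pos u x - pos v x| <= 1) =
    ~~ (~~ digit x u && digit x v && (r u x.1 < l v x.1)) &&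
    ~~ (~~ digit x v && digit x u && (r v x.1 < l u x.1)).
  (* After clearing [W], digits 0 at [u] and 1 at [v] leave [l v + W - r u <= W], that is,
     [l v <= r u]. *)
  rewrite /pos -mulrBl normrM normfV (gtr0_norm W_gt0) ler_pdivrMr // mul1r.
  have := (lM (u, x.1), lM (v, x.1), rM (u, x.1), rM (v, x.1)).
  rewrite /= !ler_norml.
  move=> [[[/andP[? ?] /andP[? ?]] /andP[? ?]] /andP[? ?]].
  case: (digit x u); case: (digit x v) => /=; rewrite -?leNgt ?andbT;
    rewrite /W; apply/idP/idP; lra.
have card_bk : #|{: 'I_b * 'I_k}| = (b * k)%N by rewrite card_prod !card_ord.
rewrite -card_bk; apply: (has_cube_rep_pos _ _ pos) => u v uv.
have separated x y j : r x j < l y j -> exists i : 'I_k,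
    ~~ digit (j, i) x && digit (j, i) y && (r x j < l y j).
  move=> xy.
  have [|i digits] := exists_digit_lt k (chain_height G (l^~ j) (r^~ j) x)
      (chain_height G (l^~ j) (r^~ j) y).
    rewrite chain_height_mono //=; last exact: adj_meet.
    by rewrite (leq_trans _ alpha_le) // chain_height_lt //; apply: adj_meet.
  by exists i; rewrite xy andbT.
split=> [adj_uv x|near].
  have /(_ x.1)[uv1 vu1] := (adjP u v uv).1 adj_uv.
  by rewrite posE !ltNge uv1 vu1 !andbF.
apply/(adjP u v uv) => j; split; rewrite leNgt; apply/negP => /separated[i sep].
- by have := near (j, i); rewrite posE sep andbF.
- by have := near (j, i); rewrite posE sep.
Qed.

Lemma cubicity_le (G : sgraph) (n : nat) :
  (0 < n)%N -> has_cube_rep R G n -> (cubicity R G <= n)%N.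
Proof.
move=> n_gt0 repG; rewrite /cubicity; case: ex_minnP => m _; apply.
by rewrite n_gt0; apply/asboolP.
Qed.

Lemma boxicity_spec (G : sgraph) :
  (0 < boxicity R G)%N /\ has_box_rep R G (boxicity R G).
Proof. by rewrite /boxicity; case: ex_minnP => m /andP[? /asboolP]. Qed.

(** Positivity of [k] is what keeps the dimension [b * k] positive. *)
Lemma ceil_log2 (n : nat) : (1 < n)%N ->
  exists k : nat, [/\ (0 < k)%N, (n <= 2 ^ k)%N &
    Num.ceil (log2 (n%:R : R)) = k%:Z].
Proof.
move=> n_gt1; have ln2_gt0 : 0 < ln 2 :> R by rewrite ln_gt0 ?ltr1n.
have log_gt0 : 0 < log2 (n%:R : R) by rewrite divr_gt0 ?ln_gt0 ?ltr1n.
have ceil_gt0 : 0 < Num.ceil (log2 (n%:R : R)) by rewrite ceil_gt0.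
exists `|Num.ceil (log2 (n%:R : R))|%N; split; [lia| |lia].
have /andP[_] := ceil_itv (log2 (n%:R : R)).
rewrite -{1}(gtz0_abs ceil_gt0) -pmulrn ler_pdivrMr // mulr_natl -lnXn //.
by rewrite ler_ln ?posrE ?exprn_gt0 ?ltr0n ?(ltnW n_gt1) // -natrX ler_nat.
Qed.

End Cubicity.

(** At independence number 1 the right side is 0 while cubicity is at least 1, hence the hypothesis
    [alpha_gt1]. *)
Theorem corollary1 (R : realType) (G : sgraph)
    (alpha_gt1 : (1 < independence_number G)%N) :
  (cubicity R G)%:Z
    <= (boxicity R G)%:Z * Num.ceil (log2 ((independence_number G)%:R : R)).
Proof.
have [k [k_gt0 alpha_le ->]] := ceil_log2 R _ alpha_gt1.
have [box_gt0 boxG] := boxicity_spec R G.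
rewrite -PoszM lez_nat; apply: cubicity_le; first by rewrite muln_gt0 box_gt0.
exact: has_cube_rep_mul.
Qed.
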